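(* Let $\omega:T^kM\to\mathbb{R}$ be a smooth point $k$-form on a differential space $(M,\mathcal{C})$. Then for any $m\in M$ there exist a neighborhood $W_m$ of $m$, a number $n\in\mathbb{N}$, functions $\alpha_1,\ldots,\alpha_n\in\mathcal{C}$ and, for any $i_1,\ldots,i_k\in\{1,2,\ldots,n\}$, a function $\omega_{i_1\ldots i_k}\in\mathcal{C}$ such that $$\omega_{|T^kW_m}=\sum_{i_1,\ldots,i_k=1}^n\big[(\omega_{i_1\ldots i_k}\circ\pi\circ\pi_1)\,d\alpha_{i_1}\otimes\cdots\otimes d\alpha_{i_k}\big]_{|T^kW_m},$$ where $T^kW_m=\bigsqcup_{p\in W_m}(T_pM)^k$.
   Context: A differential space $(M,\mathcal{C})$ is a nonempty set $M$ with a family $\mathcal{C}$ of real functions on $M$ (a differential structure) such that, with $M$ given the weakest topology making all functions of $\mathcal{C}$ continuous: (a) $\sigma(f_1,\ldots,f_r)\in\mathcal{C}$ for all $f_i\in\mathcal{C}$, $\sigma\in C^\infty(\mathbb{R}^r)$; (b) any function that near each point coincides with some element of $\mathcal{C}$ belongs to $\mathcal{C}$. The differential structure generated by a family $\mathcal{G}$ of functions is the smallest one containing $\mathcal{G}$ (it consists of functions that are locally of the form $\sigma(g_1,\ldots,g_r)$, $g_i\in\mathcal{G}$, $\sigma\in C^\infty(\mathbb{R}^r)$). For $A\subset M$, $\mathcal{C}_A$ is the structure on $A$ generated by restrictions of elements of $\mathcal{C}$. $T_mM$ is the space of linear maps $v:\mathcal{C}\to\mathbb{R}$ with $v(\alpha\beta)=\alpha(m)v(\beta)+\beta(m)v(\alpha)$;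 $TM=\bigsqcup_{m\in M} T_mM$; $\pi:TM\to M$ is the natural projection; for $\alpha\in\mathcal{C}$, $d\alpha:TM\to\mathbb{R}$, $d\alpha(v)=v(\alpha)$. $TM$ carries the structure $\mathcal{T}\mathcal{C}$ generated by $\{\alpha\circ\pi:\alpha\in\mathcal{C}\}\cup\{d\alpha:\alpha\in\mathcal{C}\}$. $T^kM=\{(v_1,\ldots,v_k)\in(TM)^k:\pi(v_1)=\cdots=\pi(v_k)\}$ with the structure $\tau^k\mathcal{C}=(\mathcal{T}\mathcal{C}\hat\otimes\cdots\hat\otimes\mathcal{T}\mathcal{C})_{T^kM}$, where the product structure on $(TM)^k$ is generated by all $f\circ\mathrm{pr}_i$, $f\in\mathcal{T}\mathcal{C}$, $i=1,\ldots,k$. $\pi_i:T^kM\to TM$, $\pi_i(v_1,\ldots,v_k)=v_i$. A point $k$-form is a map $\omega:T^kM\to\mathbb{R}$ whose restriction to $(T_mM)^k$ is $k$-linear for every $m\in M$; it is smooth if $\omega\in\tau^k\mathcal{C}$. $(d\alpha_{i_1}\otimes\cdots\otimes d\alpha_{i_k})(v_1,\ldots,v_k)=d\alpha_{i_1}(v_1)\cdots d\alpha_{i_k}(v_k)$. *)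

(* Defs.v *)
From HB Require Import structures.
From mathcomp Require Import all_boot all_order all_algebra.
From mathcomp Require Import all_classical all_reals all_analysis.

Set Implicit Arguments.
Unset Strict Implicit.
Unset Printing Implicit Defensive.

Import Order.TTheory GRing.Theory Num.Theory.
Import numFieldNormedType.Exports.

Local Open Scope classical_set_scope.
Local Open Scope ring_scope.

Section SmoothFunctionsOnRr.
Context {R : realType} {r : nat}.

Fixpoint Ck (k : nat) (f : 'rV[R]_r -> R) : Prop :=
  if k is k'.+1 then
    [/\ continuous f,
        forall (i : 'I_r) x, derivable f x (delta_mx 0 i)
      & forall i : 'I_r, Ck k' (fun x => 'D_(delta_mx 0 i) f x)]
  else continuous f.

Definition Cinfty (f : 'rV[R]_r -> R) : Prop := forall k, Ck k f.

Lemma Ck_continuous k f : Ck k f -> continuous f.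
Proof. by case: k => [|k] // []. Qed.

Lemma CkW k f : Ck k.+1 f -> Ck k f.
Proof.
elim: k f => [|k IH] f; first by case.
by move=> [cf df Hf]; split => // i; apply: IH; apply: Hf.
Qed.

Lemma Ck_cst k (c : R) : Ck k (fun=> c).
Proof.
elim: k c => [|k IH] c /=; first exact: cst_continuous.
split=> [|i x|i]; [exact: cst_continuous | exact: derivable_cst |].
suff -> : (fun x : 'rV[R]_r => 'D_(delta_mx 0 i) (fun=> c) x) = (fun=> 0).
  exact: IH.
by apply/funext => x; exact: derive_cst.
Qed.

Lemma is_derive_coord (i j : 'I_r) (x : 'rV[R]_r) :
  is_derive x (delta_mx 0 i) (fun y : 'rV[R]_r => y 0 j) ((i == j)%:R).
Proof.
have dx : derivable (@id 'rV[R]_r) x (delta_mx 0 i) by exact: derivable_id.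
have H := derive_mx dx; have /derivable_mxP Hd := dx.
apply: DeriveDef; first exact: Hd.
have := derive_id x (delta_mx 0 i : 'rV[R]_r); rewrite H => /matrixP/(_ 0 j).
by rewrite !mxE /= eq_sym.
Qed.

Lemma Ck_coord k (j : 'I_r) : Ck k (fun x : 'rV[R]_r => x 0 j).
Proof.
have cj : continuous (fun x : 'rV[R]_r => x 0 j) by exact: coord_continuous.
case: k => [|k] //=; split => // [i x|i].
  by have [] := is_derive_coord i j x.
suff -> : (fun x : 'rV[R]_r => 'D_(delta_mx 0 i)
    (fun y : 'rV[R]_r => y 0 j) x) = (fun=> (i == j)%:R) by exact: Ck_cst.
by apply/funext => x; have [] := is_derive_coord i j x.
Qed.

Lemma CkD k f g : Ck k f -> Ck k g -> Ck k (fun x => f x + g x).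
Proof.
elim: k f g => [|k IH] f g.
  by move=> cf cg x; exact: (continuousD (cf x) (cg x)).
move=> [cf df Hf] [cg dg Hg]; split=> [x|i x|i].
- exact: (continuousD (cf x) (cg x)).
- exact: (derivableD (df i x) (dg i x)).
suff -> : (fun x => 'D_(delta_mx 0 i) (fun y => f y + g y) x) =
  (fun x => 'D_(delta_mx 0 i) f x + 'D_(delta_mx 0 i) g x).
  by apply: IH; [exact: Hf|exact: Hg].
by apply/funext => x; exact: (deriveD (df i x) (dg i x)).
Qed.

Lemma CkM k f g : Ck k f -> Ck k g -> Ck k (fun x => f x * g x).
Proof.
elim: k f g => [|k IH] f g.
  by move=> cf cg x; exact: (continuousM (cf x) (cg x)).
move=> Sf Sg; move: (Sf) (Sg) => [cf df Hf] [cg dg Hg]; split=> [x|i x|i].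
- exact: (continuousM (cf x) (cg x)).
- exact: (derivableM (df i x) (dg i x)).
suff -> : (fun x => 'D_(delta_mx 0 i) (fun y => f y * g y) x) =
  (fun x => f x * 'D_(delta_mx 0 i) g x + g x * 'D_(delta_mx 0 i) f x).
  by apply: CkD; apply: IH; by [exact: CkW | exact: Hf | exact: Hg].
by apply/funext => x; exact: (deriveM (df i x) (dg i x)).
Qed.

End SmoothFunctionsOnRr.

Section DifferentialStructures.
Context {R : realType} {X : Type}.

Definition is_topology (O : set (set X)) : Prop :=
  [/\ O setT,
      forall U V, O U -> O V -> O (U `&` V)
    & forall F : set (set X), F `<=` O -> O (\bigcup_(U in F) U)].

Definition weak_open (C : set (X -> R)) : set (set X) :=
  smallest is_topology
    [set U | exists2 f, C f & exists2 V : set R, open V & U = f @^-1` V].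

Definition weak_nbhs (C : set (X -> R)) (x : X) (W : set X) : Prop :=
  exists U, [/\ weak_open C U, U x & U `<=` W].

(* The case r = 0 of [diff_comp] puts the constants in C, so C is nonempty. *)
Record is_diff_structure (C : set (X -> R)) : Prop := {
  diff_comp : forall (r : nat) (sigma : 'rV[R]_r -> R) (f : 'I_r -> X -> R),
    Cinfty sigma -> (forall i, C (f i)) -> C (fun x => sigma (\row_i f i x));
  diff_local : forall g : X -> R,
    (forall x, exists W f,
       [/\ weak_nbhs C x W, C f & forall y, W y -> g y = f y]) -> C g }.

Definition generated (G : set (X -> R)) : set (X -> R) :=
  smallest is_diff_structure G.

Lemma diff_cst C (c : R) : is_diff_structure C -> C (fun=> c).
Proof.
move=> HC; have := @diff_comp _ HC 0 (fun=> c) (fun _ _ => 0).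
by apply=> [k|[]//]; exact: Ck_cst.
Qed.

Lemma diff_comp2 C (s : 'rV[R]_2 -> R) f g : is_diff_structure C ->
  Cinfty s -> C f -> C g ->
  C (fun x => s (\row_i (if i == 0 then f x else g x))).
Proof.
move=> HC Hs Cf Cg.
have := @diff_comp _ HC 2 s (fun i x => if i == 0 then f x else g x).
by apply => // i; case: (i == 0).
Qed.

Lemma diff_lin C (a : R) f g : is_diff_structure C -> C f -> C g ->
  C (fun x => a * f x + g x).
Proof.
move=> HC Cf Cg.
pose s (x : 'rV[R]_2) := a * x 0 0 + x 0 1.
have Hs : Cinfty s.
  by move=> k; apply: CkD; [apply: CkM; [exact: Ck_cst|]|]; exact: Ck_coord.
by have := diff_comp2 HC Hs Cf Cg; rewrite /s; under eq_fun do rewrite !mxE /=.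
Qed.

Lemma diff_mul C f g : is_diff_structure C -> C f -> C g ->
  C (fun x => f x * g x).
Proof.
move=> HC Cf Cg.
pose s (x : 'rV[R]_2) := x 0 0 * x 0 1.
have Hs : Cinfty s by move=> k; apply: CkM; exact: Ck_coord.
by have := diff_comp2 HC Hs Cf Cg; rewrite /s; under eq_fun do rewrite !mxE /=.
Qed.

End DifferentialStructures.

Definition induced {R : realType} {X : Type} (C : set (X -> R)) (A : set X) :
    set (A -> R) :=
  generated [set (fun a : A => f (val a)) | f in C].
Arguments induced {R X} C A.

Record diffSpace (R : realType) := DiffSpace {
  ds_car :> Type;
  ds_inhabited : inhabited ds_car;
  ds_str : set (ds_car -> R);
  ds_axioms : is_diff_structure ds_str }.

Arguments ds_str {R} d.

Section StructureAlgebra.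
Context {R : realType} (M : diffSpace R).

Let in_str : {pred M -> R} := fun f => f \in ds_str M.

Lemma ds_str_subring : subring_closed in_str.
Proof.
have HM := ds_axioms M; split.
- by apply/mem_set; exact: diff_cst.
- move=> f g /set_mem Cf /set_mem Cg; apply/mem_set.
  rewrite (_ : f - g = fun x => (-1) * g x + f x); first exact: diff_lin.
  by apply/funext => x; rewrite mulN1r addrC.
- by move=> f g /set_mem Cf /set_mem Cg; apply/mem_set; exact: diff_mul.
Qed.

Lemma ds_str_submod : @submod_closed R (M -> R^o) in_str.
Proof.
have HM := ds_axioms M; split; first by apply/mem_set; exact: diff_cst.
by move=> a f g /set_mem Cf /set_mem Cg; apply/mem_set; exact: diff_lin.
Qed.

Definition cfun : Type := ds_str M.
HB.instance Definition _ := SubChoice.on cfun.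
HB.instance Definition _ :=
  GRing.SubChoice_isSubComPzRing.Build _ _ cfun ds_str_subring.
HB.instance Definition _ :=
  GRing.SubZmodule_isSubLmodule.Build R (M -> R^o) _ cfun
    (GRing.submod_closed_semi ds_str_submod).

End StructureAlgebra.

Section TangentBundle.
Context {R : realType} (M : diffSpace R).

Definition derivation_at (m : M) : set (cfun M -> R^o) :=
  [set v | scalar v /\
     forall a b : cfun M, v (a * b) = val a m * v b + val b m * v a].

Let in_der (m : M) : {pred cfun M -> R^o} := fun v => v \in derivation_at m.

Lemma derivation_at_submod (m : M) : submod_closed (in_der m).
Proof.
split.
  apply/mem_set; split => [a f g|a b] /=; by rewrite !mulr0 addr0.
move=> c u v /set_mem [lu du] /set_mem [lv dv]; apply/mem_set; split.
  move=> a f g; rewrite /= !fctE lu lv /GRing.scale /=.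
  by rewrite !mulrDr addrACA (mulrCA c).
move=> a b; rewrite /= !fctE du dv /GRing.scale /=.
by rewrite !mulrDr addrACA (mulrCA c) (mulrCA c (val b m)).
Qed.

Definition tangent (m : M) : Type := derivation_at m.
HB.instance Definition _ m := SubChoice.on (tangent m).
HB.instance Definition _ m :=
  GRing.SubChoice_isSubLmodule.Build R (cfun M -> R^o) _ (tangent m)
    (GRing.submod_closed_semi (derivation_at_submod m)).

Definition TM : Type := {m : M & tangent m}.

Definition tpi (v : TM) : M := projT1 v.

Definition dfun (a : cfun M) (v : TM) : R := val (projT2 v) a.

Definition TC : set (TM -> R) :=
  generated ([set (fun v => val a (tpi v)) | a in [set: cfun M]] `|`
             [set dfun a | a in [set: cfun M]]).

Definition TCk (k : nat) : set (('I_k -> TM) -> R) :=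
  generated [set F | exists2 f, TC f & exists i, F = fun v => f (v i)].
Arguments TCk k : clear implicits.

Definition fiber_product (k : nat) : set ('I_k -> TM) :=
  [set v | forall i j, tpi (v i) = tpi (v j)].
Arguments fiber_product k : clear implicits.

(* For k = 0 this is a single point rather than M: T^k M is meaningful only for
   k > 0. *)
Definition TkM (k : nat) : Type := fiber_product k.

Definition tauC (k : nat) : set (TkM k -> R) :=
  induced (TCk k) (fiber_product k).

Definition tproj (k : nat) (i : 'I_k) (v : TkM k) : TM := val v i.

Definition TkW (k : nat) (W : set M) : set (TkM k) :=
  [set v | forall i, W (tpi (tproj i v))].

Lemma fiber_subproof (k : nat) (m : M) (u : 'I_k -> tangent m) :
  (fun i => existT tangent m (u i)) \in fiber_product k.
Proof. exact/mem_set. Qed.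

Definition fiber_incl (k : nat) (m : M) (u : 'I_k -> tangent m) : TkM k :=
  exist (fun v => v \in fiber_product k) _ (fiber_subproof u).

Definition point_form (k : nat) (omega : TkM k -> R) : Prop :=
  forall (m : M) (i : 'I_k) (u : 'I_k -> tangent m),
    scalar (fun w : tangent m =>
      omega (fiber_incl (@dfwith _ (fun=> tangent m) u i w))).

Definition smooth_point_form (k : nat) (omega : TkM k -> R) : Prop :=
  point_form omega /\ tauC omega.

Definition dtensor (k : nat) (a : 'I_k -> cfun M) (v : TkM k) : R :=
  \prod_(j < k) dfun (a j) (tproj j v).

End TangentBundle.

(* Main.v *)
From HB Require Import structures.
Require Import Defs.
From mathcomp Require Import all_boot all_order all_algebra.
From mathcomp Require Import all_classical all_reals all_analysis.
Set Implicit Arguments.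
Unset Strict Implicit.
Unset Printing Implicit Defensive.
Import Order.TTheory GRing.Theory Num.Theory.
Import numFieldNormedType.Exports.
Local Open Scope classical_set_scope.
Local Open Scope ring_scope.

(** A function of the structure on [T^k M] is, near any point, a smooth function
    [s] of finitely many coordinates [a o pi] and [da o pi_j]. Apply this to
    [omega] at the zero vectors over [m]. If [p] is close to [m] then, by
    multilinearity, [t_1 ... t_k omega(v_1, ..., v_k)] is, for small [t], the
    value of [s] at [b + t_1 d_1 + ... + t_k d_k], where [b] collects the values
    [a(p)] and [d_j] the values [da(v_j)]. Differentiating once in each [t_j] at
    [0] expresses [omega(v)] through the mixed partial derivatives of [s] at
    [b], which depend smoothly on [p], and the products of the [da(v_j)]. *)

(** * Continuously differentiable functions of several variables *)

Section SmoothCalculus.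
Context {R : realType}.

(** The bound on [c] replaces membership in an interval, so that increments of either sign are
    treated alike. *)
Lemma MVT_from0 (f df : R -> R) (h : R) :
  (forall t : R, is_derive t 1 f (df t)) ->
  exists2 c, `|c| <= `|h| & f h - f 0 = df c * h.
Proof.
move=> fdf; have fC (a b : R) : {within `[a, b], continuous f}.
  by apply: derivable_within_continuous => t _; exact: ex_derive.
have [h0|/ltW h0] := leP 0 h.
  have [c] := MVT_segment h0 (fun t _ => fdf t) (fC _ _).
  rewrite in_itv /= subr0 => /andP[c0 ch] E; exists c => //.
  by rewrite !ger0_norm.
have [c] := MVT_segment h0 (fun t _ => fdf t) (fC _ _).
rewrite in_itv /= sub0r mulrN => /andP[c0 ch] E; exists c.
  by rewrite !ler0_norm // lerN2.
by rewrite -opprB E opprK.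
Qed.

(** The difference quotient of [f] along the line at parameter [t] is literally that of [f] at
    [x + t *: e] in the direction [e]. *)
Lemma is_derive_line (V W : normedModType R) (f : V -> W) x e (t : R) :
  derivable f (x + t *: e) e ->
  is_derive t 1 (fun s : R => f (x + s *: e)) ('D_e f (x + t *: e)).
Proof.
move=> df; rewrite /derive.
have E : (fun h : R => h^-1 *: (f (h *: e + (x + t *: e)) - f (x + t *: e))) =
   (fun h : R => h^-1 *: (((fun s : R => f (x + s *: e)) \o shift t) (h *: 1) -
       (fun s : R => f (x + s *: e)) t)).
  by apply/funext => h /=; rewrite /= [h%:A]mulr1 scalerDl addrCA.
by split; rewrite ?/derivable /derive -E.
Qed.

Lemma mx_entry_norm_le {m n} (A : 'M[R]_(m, n)) i j : `|A i j| <= `|A|.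
Proof.
by rewrite [leRHS]/Num.Def.normr /= mx_normrE; exact: (le_bigmax _ _ (i, j)).
Qed.

Lemma mx_norm_le {m n} (A : 'M[R]_(m, n)) (e : R) : 0 <= e ->
  (forall i j, `|A i j| <= e) -> `|A| <= e.
Proof.
move=> e0 Ae; rewrite [leLHS]/Num.Def.normr /= mx_normrE.
by apply: (bigmax_le _ e0) => -[i j] _.
Qed.

(* Telescoping along the coordinates: consecutive corners of the box spanned by
   [x] and [x + h] differ in one coordinate, where the mean value theorem
   applies. *)
Lemma increment_le (r : nat) (f : 'rV[R]_r -> R) x h (e : R) :
  (forall i y, derivable f y (delta_mx 0 i)) ->
  (forall i y, `|y - x| <= `|h| ->
     `|'D_(delta_mx 0 i) f y - 'D_(delta_mx 0 i) f x| <= e) ->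
  `|f (x + h) - f x - \sum_i h 0 i * 'D_(delta_mx 0 i) f x| <= r%:R * e * `|h|.
Proof.
move=> df fe.
pose z (k : nat) := x + \row_(i < r) (if (i < k)%N then h 0 i else 0).
have zS (k : 'I_r) : z k.+1 = z k + h 0 k *: delta_mx 0 k.
  rewrite /z -addrA; congr (_ + _); apply/rowP => i; rewrite !mxE /= ltnS.
  rewrite leq_eqVlt -[(i : nat) == k]/(i == k); case: eqVneq => [->|_] /=.
    by rewrite ltnn mulr1 add0r.
  by rewrite mulr0 addr0.
have z0 : z 0 = x.
  rewrite /z [X in _ + X](_ : _ = 0) ?addr0 //.
  by apply/rowP => i; rewrite !mxE.
have zr : z r = x + h by congr (_ + _); apply/rowP => i; rewrite !mxE ltn_ord.
rewrite -zr -{1}z0 -(telescope_sumr (fun k => f (z k))) // big_mkord -sumrB.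
apply: (le_trans (ler_norm_sum _ _ _)).
suff H (k : 'I_r) :
    `|f (z k.+1) - f (z k) - h 0 k * 'D_(delta_mx 0 k) f x| <= e * `|h|.
  apply: (le_trans (ler_sum _ (fun k _ => H k))).
  by rewrite sumr_const card_ord -mulrA mulr_natl.
have [t th] := MVT_from0 (h 0 k)
  (fun t => is_derive_line (df k (z k + t *: delta_mx 0 k))).
rewrite scale0r addr0 -zS => ->.
rewrite mulrC -mulrBr normrM mulrC ler_pM ?mx_entry_norm_le// fe//.
(* The intermediate point minus [x] has entries [h 0 i] before [k], [t] at [k] and 0 after, all
   bounded by the norm of [h]. *)
apply: mx_norm_le => // i j; rewrite ord1 /z (addrC x) addrAC addrK !mxE /=.
rewrite (eq_sym (_ k)); case: eqVneq => [->|_]; last first.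
  by rewrite mulr0 addr0; case: ifP => _; rewrite ?normr0 ?mx_entry_norm_le.
by rewrite ltnn mulr1 add0r (le_trans th)// mx_entry_norm_le.
Qed.

Lemma Ck_sum (r k n : nat) (f : 'I_n -> 'rV[R]_r -> R) :
  (forall i, Ck k (f i)) -> Ck k (fun x => \sum_i f i x).
Proof.
elim: n f => [|n IH] f fk.
  by under eq_fun do rewrite big_ord0; exact: Ck_cst.
by under eq_fun do rewrite big_ord_recl; apply: CkD => //; exact: IH.
Qed.

Lemma is_diff_increment (V W : normedModType R) (f : V -> W)
    (L : {linear V -> W}) (x : V) : continuous L ->
  (forall e : R, 0 < e -> exists2 d : R, 0 < d &
     forall h, `|h| < d -> `|f (x + h) - f x - L h| <= e * `|h|) ->
  is_diff x f L.
Proof.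
move=> LC fL; have xL : f \o shift x = cst (f x) + L +o_ 0 id.
  apply/eqaddoP => e /fL[d d0 Hd].
  apply/nbhs_normP; exists d => // h /=; rewrite sub0r normrN => /Hd.
  by rewrite -[(_ - _) h]/(f (h + x) - (f x + L h)) opprD addrA [h + x]addrC.
have dL := diff_unique LC xL.
by split => //; apply/diff_locallyP; rewrite dL.
Qed.

(** Continuity makes the partial derivatives vary little near [x]; [increment_le] turns this into
    the first-order estimate. *)
Lemma C1_is_diff (r : nat) (f : 'rV[R]_r -> R) (x : 'rV[R]_r) : Ck 1 f ->
  is_diff x f (fun h => \sum_i h 0 i * 'D_(delta_mx 0 i) f x).
Proof.
move=> [_ df cf].
pose L (h : 'rV[R]_r) : R := \sum_i h 0 i * 'D_(delta_mx 0 i) f x.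
have Llin : linear L.
  move=> a u v; rewrite /L scaler_sumr -big_split /=; apply: eq_bigr => i _.
  by rewrite !mxE mulrDl [a *: _]mulrA.
pose LM := GRing.isLinear.Build _ _ _ _ _ Llin.
pose LL : {linear 'rV[R]_r -> R} := HB.pack L LM.
have LC : continuous LL.
  by apply: (@Ck_sum _ 0) => i; apply: (@CkM _ _ 0);
    [exact: Ck_coord|exact: Ck_cst].
apply: (@is_diff_increment _ _ f LL x LC) => e e0.
(* Absorbs the factor [r] of [increment_le]; the successor keeps the divisor nonzero when
   [r = 0]. *)
pose e' := e / r.+1%:R.
have e'0 : 0 < e' by rewrite divr_gt0.
have : \forall y \near x,
    forall i, `|'D_(delta_mx 0 i) f y - 'D_(delta_mx 0 i) f x| <= e'.
  apply: (filter_forall (nbhs_filter x)) => i.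
  have /cvgrPdist_le /(_ _ e'0) := cf i x.
  by apply: filterS => y; rewrite distrC.
move=> /nbhs_normP[d d0 Hd]; exists d => // h hd.
have H i y (yx : `|y - x| <= `|h|) :
    `|'D_(delta_mx 0 i) f y - 'D_(delta_mx 0 i) f x| <= e'.
  by apply: (Hd y _ i); rewrite /= distrC (le_lt_trans yx).
apply: le_trans (increment_le df H) _.
rewrite ler_wpM2r // /e' mulrCA ler_piMr ?(ltW e0) //.
by rewrite ler_pdivrMr // mul1r ler_nat.
Qed.

Lemma C1_derive (r : nat) (f : 'rV[R]_r -> R) (x v : 'rV[R]_r) : Ck 1 f ->
  is_derive x v f (\sum_i v 0 i * 'D_(delta_mx 0 i) f x).
Proof.
move=> f1; have fd := C1_is_diff x f1; split; first exact: diff_derivable.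
by rewrite deriveE // diff_val.
Qed.

(** The [g i] are only derivable in one direction, so the chain rule is applied to the curve [G] in
    one real variable, where derivability and differentiability agree. *)
Lemma C1_derive_comp (r : nat) (V : normedModType R) (s : 'rV[R]_r -> R)
    (g : 'I_r -> V -> R) (x v : V) :
  Ck 1 s -> (forall i, derivable (g i) x v) ->
  is_derive x v (fun y => s (\row_i g i y))
    (\sum_i 'D_v (g i) x * 'D_(delta_mx 0 i) s (\row_i g i x)).
Proof.
move=> s1 dg.
pose G (t : R) : 'rV[R]_r := \row_i g i (x + t *: v).
have dG : is_derive (0 : R) 1 G (\row_i 'D_v (g i) x).
  have D i : is_derive (0 : R) 1 (fun t : R => g i (x + t *: v)) ('D_v (g i) x).
    rewrite -{2}[x]addr0 -(scale0r v); apply: is_derive_line.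
    by rewrite scale0r addr0.
  have GD : derivable G (0 : R) 1.
    apply/derivable_mxP => a i; rewrite /G; under eq_fun do rewrite mxE.
    by have [] := D i.
  split => //; rewrite derive_mx //; apply/matrixP => a i; rewrite !mxE.
  rewrite /G; under eq_fun do rewrite mxE; by have [] := D i.
have sd := C1_is_diff (G 0) s1.
have Gd : differentiable G (0 : R) by apply/derivable1_diffP; have [] := dG.
have sGd : differentiable (s \o G) (0 : R) by exact: differentiable_comp.
have E : (fun h : R =>
     h^-1 *: (s (\row_i g i (h *: v + x)) - s (\row_i g i x))) =
   (fun h : R => h^-1 *: (((s \o G) \o shift 0) (h *: 1) - (s \o G) 0)).
  apply/funext => h; rewrite /G /= [h%:A]mulr1.
  by rewrite addr0 scale0r addr0 [x + _]addrC.
have sG1 : 'D_1 (s \o G) 0 =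
    \sum_i 'D_v (g i) x * 'D_(delta_mx 0 i) s (\row_i g i x).
  rewrite deriveE // diff_comp // /= diff_val -deriveE // derive_val.
  by rewrite /G scale0r addr0; apply: eq_bigr => i _; rewrite mxE.
split; first by rewrite /derivable /= E; exact: diff_derivable.
by rewrite /derive /= E -[LHS]/('D_1 (s \o G) 0).
Qed.

Lemma continuous_row (T : topologicalType) (r : nat) (g : 'I_r -> T -> R) :
  (forall i, continuous (g i)) -> continuous (fun x => \row_i g i x).
Proof.
move=> gC x; apply/cvgrPdist_le => e e0.
have : \forall y \near x, forall i, `|g i x - g i y| <= e.
  by apply: filter_forall => i; have /cvgrPdist_le := gC i x; exact.
apply: filterS => y H; apply: mx_norm_le; first exact: ltW.
by move=> a i; rewrite !mxE.
Qed.

Lemma Ck_le (r k l : nat) (f : 'rV[R]_r -> R) : (l <= k)%N -> Ck k f -> Ck l f.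
Proof.
elim: k => [|k IH]; first by case: l.
by rewrite leq_eqVlt => /predU1P[->//|/IH h /CkW].
Qed.

(** Induction on [k]: a partial derivative of the composite is a sum of products of derivatives of
    the [g i] with composites of partial derivatives of [s]. *)
Lemma Ck_comp (q r k : nat) (s : 'rV[R]_q -> R) (g : 'I_q -> 'rV[R]_r -> R) :
  Ck k s -> (forall i, Ck k (g i)) -> Ck k (fun x => s (\row_i g i x)).
Proof.
elim: k s g => [|k IH] s g sk gk.
  by move=> x; apply: continuous_comp; [exact: (continuous_row gk)|exact: sk].
have dg j x : forall i, derivable (g i) x (delta_mx 0 j).
  by move=> i; have [_ + _] := gk i; exact.
have D j x := C1_derive_comp (Ck_le (ltn0Sn k) sk) (dg j x).
split => [x|j x|j].
- apply: continuous_comp; last exact: (Ck_continuous sk).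
  by apply: continuous_row => i; exact: (Ck_continuous (gk i)).
- by have [] := D j x.
- have -> : (fun x => 'D_(delta_mx 0 j) (fun y => s (\row_i g i y)) x) =
    (fun x => \sum_i 'D_(delta_mx 0 j) (g i) x *
      'D_(delta_mx 0 i) s (\row_i g i x)).
    by apply/funext => x; have [] := D j x.
  apply: Ck_sum => i; apply: CkM; first by have [_ _] := gk i; exact.
  apply: (IH ('D_(delta_mx 0 i) s)) => [|l]; last exact: CkW.
  by have [_ _] := sk; exact.
Qed.

Lemma Cinfty_comp (q r : nat) (s : 'rV[R]_q -> R) (g : 'I_q -> 'rV[R]_r -> R) :
  Cinfty s -> (forall i, Cinfty (g i)) -> Cinfty (fun x => s (\row_i g i x)).
Proof. by move=> sC gC k; apply: Ck_comp => // i; exact: gC. Qed.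

End SmoothCalculus.

(** * Functions generated by a family *)

Section WeakTopology.
Context {R : realType}.

Lemma weak_open_topology (X : Type) (C : set (X -> R)) :
  is_topology (weak_open C).
Proof.
split.
- by move=> O [[OT _ _] _].
- move=> U V CU CV O HO; have [[_ OI _] _] := HO.
  by apply: OI; [exact: CU|exact: CV].
- move=> F FC O HO; have [[_ _ OU] _] := HO; apply: OU => U /FC; exact.
Qed.

Lemma weak_open_preimage (X : Type) (C : set (X -> R)) f (V : set R) :
  C f -> open V -> weak_open C (f @^-1` V).
Proof.
by move=> Cf oV O [_]; apply; exists f => //; exists V.
Qed.

Lemma weak_open_bigcap (X : Type) (C : set (X -> R)) n (U : 'I_n -> set X) :
  (forall i, weak_open C (U i)) -> weak_open C [set x | forall i, U i x].
Proof.
have [oT oI _] := weak_open_topology C.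
elim: n U => [|n IH] U CU.
  by rewrite (_ : [set _ | _] = setT) //; apply/seteqP; split => // x _ [].
rewrite (_ : [set _ | _] = U ord0 `&` [set x | forall i, U (lift ord0 i) x]).
  by apply: oI => //; exact: IH.
apply/seteqP; split => x /= => [Ux|[U0 Ux] i]; first by split.
by case: (unliftP ord0 i) => [j ->|->].
Qed.

(** By minimality of generated structures, this reduces the claim that a whole generated structure
    pulls back into [L] to its generators. *)
Lemma is_diff_structure_pullback (X Y : Type) (phi : Y -> X)
    (L : set (Y -> R)) :
  is_diff_structure L -> is_diff_structure [set F : X -> R | L (F \o phi)].
Proof.
(* Continuity of [phi]: the sets with weakly open preimage form a topology containing the subbasic
   sets. *)
move=> LD; have weakP : weak_open [set F : X -> R | L (F \o phi)] `<=`
    [set U | weak_open L (phi @^-1` U)].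
  have [oT oI oU] := weak_open_topology L.
  apply: smallest_sub.
    split=> [|U V|F FL] /=; [exact: oT|exact: oI|].
    rewrite (_ : _ @^-1` _ = \bigcup_(V in [set phi @^-1` U | U in F]) V).
      by apply: oU => _ [U FU <-]; exact: FL.
    by rewrite bigcup_image preimage_bigcup.
  by move=> _ [f Lf [V oV ->]] /=; exact: (@weak_open_preimage _ L (f \o phi)).
split=> [r s f sC Lf|g gL] /=.
  exact: (Defs.diff_comp LD (f := fun i => f i \o phi) sC Lf).
apply: (diff_local LD) => y; have [W [f [[U [oU Uy UW]] Lf gf]]] := gL (phi y).
exists (phi @^-1` W), (f \o phi); split => //.
  exists (phi @^-1` U); split => //; first exact: weakP.
  by move=> z; exact: UW.
by move=> z; exact: gf.
Qed.

End WeakTopology.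

(** * Functions depending locally and smoothly on finitely many generators *)

Section LocallyGenerated.
Context {R : realType} {X : Type}.
Implicit Types (G : set (X -> R)) (x y : X).

Definition family_ball r (g : 'I_r -> X -> R) x (e : R) : set X :=
  [set y | forall i, `|g i y - g i x| < e].

Definition cat_family T r1 r2 (g1 : 'I_r1 -> T) (g2 : 'I_r2 -> T)
    (i : 'I_(r1 + r2)) : T :=
  match fintype.split i with inl j => g1 j | inr j => g2 j end.

Lemma cat_family_l T r1 r2 (g1 : 'I_r1 -> T) (g2 : 'I_r2 -> T) i :
  cat_family g1 g2 (lshift r2 i) = g1 i.
Proof. by rewrite /cat_family -[lshift _ _]/(unsplit (inl i)) unsplitK. Qed.

Lemma cat_family_r T r1 r2 (g1 : 'I_r1 -> T) (g2 : 'I_r2 -> T) i :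
  cat_family g1 g2 (rshift r1 i) = g2 i.
Proof. by rewrite /cat_family -[rshift _ _]/(unsplit (inr i)) unsplitK. Qed.

Lemma cat_familyP T (P : set T) r1 r2 (g1 : 'I_r1 -> T) (g2 : 'I_r2 -> T) :
  (forall i, P (g1 i)) -> (forall i, P (g2 i)) ->
  forall i, P (cat_family g1 g2 i).
Proof. by move=> P1 P2 i; rewrite /cat_family; case: fintype.split. Qed.

Lemma family_ball_cat r1 r2 (g1 : 'I_r1 -> X -> R) (g2 : 'I_r2 -> X -> R)
    x e1 e2 :
  family_ball (cat_family g1 g2) x (Num.min e1 e2) `<=`
  family_ball g1 x e1 `&` family_ball g2 x e2.
Proof.
move=> y H; split=> i.
  by have := H (lshift r2 i); rewrite cat_family_l lt_min => /andP[].
by have := H (rshift r1 i); rewrite cat_family_r lt_min => /andP[].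
Qed.

Lemma min_gt0 (e1 e2 : R) : 0 < e1 -> 0 < e2 -> 0 < Num.min e1 e2.
Proof. by move=> ? ?; rewrite lt_min; apply/andP. Qed.

(** Explicit candidate for the structure generated by [G]. Neighborhoods are balls for the
    generators themselves, and the same finite family serves for the ball and for the arguments of
    [s]. *)
Definition locally_generated G : set (X -> R) :=
  [set f | forall x, exists r (g : 'I_r -> X -> R) (e : R) (s : 'rV[R]_r -> R),
    [/\ forall i, G (g i), 0 < e, Cinfty s &
        forall y, family_ball g x e y -> f y = s (\row_i g i y)]].

Lemma Cinfty_reindex q r (s : 'rV[R]_q -> R) (h : 'I_q -> 'I_r) : Cinfty s ->
  Cinfty (fun z : 'rV[R]_r => s (\row_i z 0 (h i))).
Proof. by move=> sC; apply: Cinfty_comp => // i k; exact: Ck_coord. Qed.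

(** Finitely many functions share one finite family of generators: concatenate the families, take
    the smaller radius and let each smooth function read its own coordinates. *)
Lemma locally_generated_family G (T : eqType) (F : T -> X -> R) (l : seq T) x :
  (forall j, locally_generated G (F j)) ->
  exists r (g : 'I_r -> X -> R) (e : R) (s : T -> 'rV[R]_r -> R),
    [/\ forall i, G (g i), 0 < e, forall j, Cinfty (s j) &
        forall y, family_ball g x e y ->
          forall j, j \in l -> F j y = s j (\row_i g i y)].
Proof.
move=> FG; elim: l => [|j0 l [r1 [g1 [e1 [s1 [G1 e10 s1C E1]]]]]].
  exists 0, (fun _ _ => 0), 1, (fun _ _ => 0); split => // [[]//|j k].
  exact: Ck_cst.
have [r2 [g2 [e2 [s2 [G2 e20 s2C E2]]]]] := FG j0 x.
exists (r1 + r2)%N, (cat_family g1 g2), (Num.min e1 e2).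
exists (fun j (z : 'rV[R]_(r1 + r2)) =>
  if j == j0 then s2 (\row_i z 0 (rshift r1 i))
  else s1 j (\row_i z 0 (lshift r2 i))).
split; [exact: cat_familyP|exact: min_gt0|move=> j|].
  by case: eqP => _; exact: Cinfty_reindex.
move=> y /family_ball_cat[/E1 y1 /E2 y2] j; rewrite inE.
case: eqVneq => [->|_] /= jl.
  by rewrite y2; congr s2; apply/rowP => i; rewrite !mxE cat_family_r.
by rewrite y1 //; congr s1; apply/rowP => i; rewrite !mxE cat_family_l.
Qed.

(** The sets containing a ball around each of their points form a topology, and it contains the
    subbasic sets because smooth functions are continuous. *)
Lemma locally_generated_open G U x : weak_open (locally_generated G) U -> U x ->
  exists r (g : 'I_r -> X -> R) (e : R),
    [/\ forall i, G (g i), 0 < e & family_ball g x e `<=` U].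
Proof.
pose O : set (set X) := [set U | forall x, U x ->
  exists r (g : 'I_r -> X -> R) (e : R),
    [/\ forall i, G (g i), 0 < e & family_ball g x e `<=` U]].
suff H : weak_open (locally_generated G) `<=` O by move=> /H; exact.
apply: smallest_sub.
  split=> [y _|U1 U2 O1 O2 y [/O1 [r1 [g1 [e1 [G1 e10 E1]]]]]|F FO y [V FV Vy]].
  - by exists 0, (fun _ _ => 0), 1; split => // -[].
  - move=> /O2 [r2 [g2 [e2 [G2 e20 E2]]]].
    exists (r1 + r2)%N, (cat_family g1 g2), (Num.min e1 e2).
    split; [exact: cat_familyP|exact: min_gt0|].
    by move=> z /family_ball_cat[/E1 ? /E2 ?].
  - have [r [g [e [Gg e0 E]]]] := FO _ FV _ Vy.
    by exists r, g, e; split => // z /E Vz; exists V.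
move=> _ [f fG [V oV ->]] y /= Vfy.
have [r [g [e [s [Gg e0 sC E]]]]] := fG y.
have fy : f y = s (\row_i g i y) by apply: E => i; rewrite subrr normr0.
have /nbhs_normP[d d0 dV] : nbhs (\row_i g i y) (s @^-1` V).
  apply: (Ck_continuous (sC 0)); apply: open_nbhs_nbhs; split => //.
  by rewrite -fy.
(* [e] keeps the local formula valid; [d / 2] restores a strict bound, since the entrywise estimate
   of the norm is only a weak inequality. *)
exists r, g, (Num.min e (d / 2)); split => //.
  by apply: min_gt0 => //; exact: divr_gt0.
move=> z zy; rewrite /preimage /= E; last first.
  by move=> i; have := zy i; rewrite lt_min => /andP[].
apply: dV; rewrite /= distrC (@le_lt_trans _ _ (d / 2)) //; last first.
  by rewrite ltr_pdivrMr // ltr_pMr // ltr1n.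
apply: mx_norm_le => [|a i]; first by rewrite divr_ge0 // ltW.
by rewrite !mxE; have := zy i; rewrite lt_min => /andP[_ /ltW].
Qed.

Lemma locally_generated_structure G : is_diff_structure (locally_generated G).
Proof.
split=> [q s f sC fG x|f fG x].
  have [r [g [e [t [Gg e0 tC E]]]]] :=
    locally_generated_family (enum 'I_q) x fG.
  exists r, g, e, (fun z => s (\row_i t i z)); split => //.
    exact: Cinfty_comp.
  move=> y /E fy; congr s; apply/rowP => i; rewrite !mxE fy //.
  by rewrite mem_enum.
have [W [h [[U [oU Ux UW]] hG fh]]] := fG x.
have [r1 [g1 [e1 [G1 e10 E1]]]] := locally_generated_open oU Ux.
have [r2 [g2 [e2 [s [G2 e20 sC E2]]]]] := hG x.
exists (r1 + r2)%N, (cat_family g1 g2), (Num.min e1 e2).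
(* The first [r1] generators only force the ball into [W]; the smooth function ignores their
   values. *)
exists (fun z : 'rV[R]_(r1 + r2) => s (\row_i z 0 (rshift r1 i))).
split; [exact: cat_familyP|exact: min_gt0|exact: Cinfty_reindex|].
move=> y /family_ball_cat[/E1/UW/fh -> /E2 ->]; congr s.
by apply/rowP => i; rewrite !mxE cat_family_r.
Qed.

Lemma sub_locally_generated G : G `<=` locally_generated G.
Proof.
move=> g Gg x; exists 1, (fun=> g), 1, (fun z => z 0 0); split => //.
  by move=> k; exact: Ck_coord.
by move=> y _; rewrite mxE.
Qed.

End LocallyGenerated.

(** * Mixed derivatives of a locally multilinear function *)

Section MultilinearExtraction.
Context {R : realType}.

Definition ffun_cons k (T : Type) (i : T) (I : {ffun 'I_k -> T}) :
    {ffun 'I_k.+1 -> T} :=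
  [ffun j => oapp I i (unlift ord0 j)].

Lemma big_ffun_recl k (T : finType) (V : nmodType)
    (F : {ffun 'I_k.+1 -> T} -> V) :
  \sum_I F I = \sum_i \sum_I F (ffun_cons i I).
Proof.
rewrite pair_big /=; apply: (reindex (fun p => ffun_cons p.1 p.2)).
apply: onW_bij; exists (fun I : {ffun 'I_k.+1 -> T} =>
  (I ord0, [ffun j => I (lift ord0 j)])).
  move=> [i I] /=; congr pair; first by rewrite ffunE unlift_none.
  by apply/ffunP => j; rewrite !ffunE liftK.
move=> I; apply/ffunP => j; rewrite ffunE /=.
by case: (unliftP ord0 j) => [l ->|->] //=; rewrite ffunE.
Qed.

Fixpoint partials r (I : seq 'I_r) (f : 'rV[R]_r -> R) : 'rV[R]_r -> R :=
  if I is i :: I' then partials I' ('D_(delta_mx 0 i) f) else f.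

Lemma Cinfty_partial r (f : 'rV[R]_r -> R) i :
  Cinfty f -> Cinfty ('D_(delta_mx 0 i) f).
Proof. by move=> fC k; have [_ _] := fC k.+1; exact. Qed.

Lemma Cinfty_partials r (I : seq 'I_r) (f : 'rV[R]_r -> R) :
  Cinfty f -> Cinfty (partials I f).
Proof. by elim: I f => // i I IH f fC; apply: IH; exact: Cinfty_partial. Qed.

Lemma Cinfty_lin_comb r n (a : 'I_n -> R) (f : 'I_n -> 'rV[R]_r -> R) :
  (forall i, Cinfty (f i)) -> Cinfty (fun x => \sum_i a i * f i x).
Proof.
move=> fC k; apply: Ck_sum => i; apply: CkM; [exact: Ck_cst|exact: fC].
Qed.

Lemma partials_lin_comb r (I : seq 'I_r) n (a : 'I_n -> R)
    (f : 'I_n -> 'rV[R]_r -> R) : (forall i, Cinfty (f i)) ->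
  partials I (fun x => \sum_i a i * f i x) =
  (fun x => \sum_i a i * partials I (f i) x).
Proof.
elim: I f => // j I IH f fC /=.
rewrite -IH => [|i]; last exact: Cinfty_partial.
congr partials; apply/funext => x.
have df i : is_derive x (delta_mx 0 j) (fun x => a i * f i x)
    (a i * 'D_(delta_mx 0 j) (f i) x).
  have [_ /(_ j x) dfi _] := fC i 1; exact: (is_deriveZ (a i) (derivableP dfi)).
have := is_derive_sum df.
rewrite (_ : \sum_i _ = (fun x => \sum_i a i * f i x)); first by case.
by apply/funext => y; rewrite fct_sumE.
Qed.

(** Induction on [k]: differentiating in the first variable at 0 replaces [s] by its derivative
    along [d ord0], which satisfies the same identity in the remaining variables. *)
Lemma multilinear_coeff r k (s : 'rV[R]_r -> R) (b : 'rV[R]_r)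
    (d : 'I_k -> 'rV[R]_r) (c e : R) : Cinfty s -> 0 < e ->
  (forall t : 'I_k -> R, (forall j, `|t j| < e) ->
     s (b + \sum_j t j *: d j) = c * \prod_j t j) ->
  c = \sum_(I : {ffun 'I_k -> 'I_r})
        (\prod_j d j 0 (I j)) * partials (map I (enum 'I_k)) s b.
Proof.
move=> + e0; elim: k s d => [|k IH] s d sC H.
  have -> : enum 'I_0 = [::] by apply: size0nil; rewrite size_enum_ord.
  have := H (fun=> 0); rewrite !big_ord0 addr0 mulr1 => <-; last by case.
  under eq_bigr do rewrite big_ord0 mul1r.
  by rewrite sumr_const card_ffun !card_ord expn0.
pose s' x := \sum_i d ord0 0 i * 'D_(delta_mx 0 i) s x.
have s'C : Cinfty s' by apply: Cinfty_lin_comb => i; exact: Cinfty_partial.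
have -> := IH s' (fun j => d (lift ord0 j)) s'C; last first.
  move=> t te; set y := b + _.
  pose K := c * \prod_j t j.
  have L : is_derive (0 : R) 1 (fun u => s (y + u *: d ord0)) (s' y).
    have [ds <-] : is_derive y (d ord0) s (s' y) by exact: C1_derive (sC 1).
    rewrite -{2}[y]addr0 -(scale0r (d ord0)); apply: is_derive_line.
    by rewrite scale0r addr0.
  (* The hypothesis holds for small parameters only, which suffices for a derivative at 0. *)
  have E : {near (0 : R), (fun u => s (y + u *: d ord0)) =1 (fun u => K * u)}.
    apply/nbhs_normP; exists e => // u /=; rewrite sub0r normrN => ue.
    have := H (fun j => oapp t u (unlift ord0 j)).
    rewrite !big_ord_recl /= unlift_none /=.
    under eq_bigr do rewrite liftK /=.
    under [X in _ * (_ * X)]eq_bigr do rewrite liftK /=.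
    rewrite addrCA [u *: _ + _]addrC -/y mulrCA mulrC => -> //.
    by move=> j; case: unliftP => [l _|_] /=.
  have [_ <-] := L.
  rewrite (near_eq_derive _ E).
  have := is_deriveZ K (is_derive_id (0 : R) 1).
  by case=> _; rewrite [K *: 1]mulr1.
rewrite big_ffun_recl exchange_big; apply: eq_bigr => I _ /=.
rewrite partials_lin_comb => [|i]; last exact: Cinfty_partial.
rewrite mulr_sumr; apply: eq_bigr => i _.
rewrite enum_ordSl /= big_ord_recl ffunE unlift_none /= mulrCA mulrA.
congr (_ * _ * _); first by apply: eq_bigr => j _; rewrite ffunE liftK.
rewrite -map_comp; congr partials.
by apply: eq_map => j; rewrite /= ffunE liftK.
Qed.

End MultilinearExtraction.

(** * The fiber product bundle *)

Section FiberProduct.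
Context {R : realType} {M : diffSpace R} {k : nat}.

(** The generating coordinates of the bundle: [None] gives [a] at the base point, read off through
    the slot [o], and [Some j] gives the differential of [a] on the [j]-th vector. *)
Definition bundle_coord (o : 'I_k) (s : option 'I_k) (a : cfun M)
    (v : TkM M k) : R :=
  if s is Some j then dfun a (tproj j v) else val a (tpi (tproj o v)).

Lemma tpi_tproj (v : TkM M k) i j : tpi (tproj i v) = tpi (tproj j v).
Proof. by case: v => v vP; exact: (set_mem vP). Qed.

(** The structure is generated in three layers: restriction, product, tangent bundle. Each is peeled
    off by minimality, pulling back along the inclusion and then along a projection. *)
Lemma tauC_locally_generated (o : 'I_k) :
  @tauC R M k `<=`
  locally_generated [set F | exists s a, F = bundle_coord o s a].
Proof.
set L := locally_generated _.
have LD : is_diff_structure L by exact: locally_generated_structure.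
apply: smallest_sub => // _ [F FT <-]; move: F FT.
apply: smallest_sub; first exact: (is_diff_structure_pullback val LD).
move=> _ [f fT [i ->]]; move: f fT.
apply: smallest_sub.
  exact: (is_diff_structure_pullback (@tproj R M k i) LD).
move=> _ [|] [a _ <-]; apply: sub_locally_generated.
  exists None, a; apply/funext => v /=; congr (val a _); exact: tpi_tproj.
by exists (Some i), a.
Qed.

(** The base points of the components are only provably equal to [p]; this transports the components
    into the single type [tangent p]. *)
Lemma fiber_inclP (v : TkM M k) (p : M) : (forall j, tpi (tproj j v) = p) ->
  exists u : 'I_k -> tangent p, v = fiber_incl u.
Proof.
move=> vp; have H j : exists w : tangent p, tproj j v = existT _ p w.
  by move: (vp j); case: (tproj j v) => q w /= qp; subst q; exists w.
have [u Hu] := choice H; exists u; apply: val_inj; apply/funext => j.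
exact: Hu.
Qed.

Lemma scalar_scale (V : lmodType R) (f : V -> R) (a : R) x :
  scalar f -> f (a *: x) = a * f x.
Proof.
move=> lf; have f0 : f 0 = 0.
  by have := lf (-1) 0 0; rewrite scaler0 addr0 mulN1r addNr.
by have := lf a x 0; rewrite !addr0 f0 addr0.
Qed.

Lemma point_form_scale (omega : TkM M k -> R) (m : M) (u : 'I_k -> tangent m)
    (t : 'I_k -> R) : point_form omega ->
  omega (fiber_incl (fun j => t j *: u j)) =
  (\prod_j t j) * omega (fiber_incl u).
Proof.
(* Slots are scaled one at a time: [w n] has its first [n] vectors scaled, and passing to [w n.+1]
   uses linearity in slot [n]. *)
move=> oP; pose w n (j : 'I_k) := if (j < n)%N then t j *: u j else u j.
have H n : (n <= k)%N -> omega (fiber_incl (w n)) =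
    (\prod_(j < k | (j < n)%N) t j) * omega (fiber_incl u).
  elim: n => [|n IH] nk; first by rewrite big_pred0 // mul1r.
  pose i := Ordinal nk.
  have wS : w n.+1 = @dfwith _ (fun=> tangent m) (w n) i (t i *: u i).
    apply/funext => j; have [<-|ij] := eqVneq i j.
      by rewrite dfwithin /w /= ltnSn.
    rewrite dfwithout // /w ltnS leq_eqVlt.
    by rewrite -[(j : nat) == n]/(j == i) eq_sym (negbTE ij).
  rewrite wS (scalar_scale _ _ (oP m i (w n))).
  have -> : @dfwith _ (fun=> tangent m) (w n) i (u i) = w n.
    apply/funext => j; have [<-|ij] := eqVneq i j; last by rewrite dfwithout.
    by rewrite dfwithin /w /= ltnn.
  rewrite (IH (ltnW nk)) mulrA [in RHS](bigD1 i (ltnSn n)) /=.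
  congr (_ * _ * _).
  apply: eq_bigl => j; rewrite ltnS [RHS]andbC ltn_neqAle.
  by rewrite -[(j : nat) == n]/(j == i); case: eqVneq => //=;
    rewrite ?andbF ?andbT.
have := H k (leqnn k); rewrite /w.
under eq_fun do rewrite ltn_ord.
by move=> ->; congr (_ * _); apply: eq_bigl => j; rewrite ltn_ord.
Qed.

End FiberProduct.

(** * Local coefficients of a smooth point form *)

Theorem theorem1 (R : realType) (M : diffSpace R) (k : nat) (k_gt0 : (0 < k)%N)
    (omega : TkM M k -> R) (omega_smooth : smooth_point_form omega) (m : M) :
  exists (W : set M) (n : nat) (alpha : 'I_n -> cfun M)
         (omega_ : {ffun 'I_k -> 'I_n} -> cfun M),
    weak_nbhs (ds_str M) m W /\
    forall v : TkM M k, TkW W v ->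
      omega v = \sum_(i : {ffun 'I_k -> 'I_n})
        val (omega_ i) (tpi (tproj (Ordinal k_gt0) v)) *
        dtensor (fun j => alpha (i j)) v.
Proof.
have HM := ds_axioms M; set o := Ordinal k_gt0.
have [omegaP /(tauC_locally_generated o) omegaL] := omega_smooth.
have [r [g [e [s [gG e0 sC gs]]]]] :=
  omegaL (fiber_incl (fun _ : 'I_k => 0 : tangent m)).
have [sl slP] := choice gG; have [a aP] := choice slP => {gG slP}.
have strV (f : cfun M) : ds_str M (val f) by exact: set_mem (valP f).
(* The coordinates of the zero vectors over [p]: every differential vanishes there. *)
pose base (p : M) : 'rV[R]_r :=
  \row_i (if sl i is Some _ then 0 else val (a i) p).
have baseC (tau : 'rV[R]_r -> R) :
    Cinfty tau -> ds_str M (fun p => tau (base p)).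
  move=> tauC; apply: (Defs.diff_comp HM
    (f := fun i p => if sl i is Some _ then 0 else val (a i) p) tauC) => i.
  by case: (sl i) => [_|]; [exact: Defs.diff_cst|exact: strV].
(* The factor in front keeps only the multi-indices whose [j]-th coordinate is a differential in
   slot [j], for every [j]. *)
pose coef (I : {ffun 'I_k -> 'I_r}) (p : M) : R :=
  [forall j, sl (I j) == Some j]%:R * partials (map I (enum 'I_k)) s (base p).
have coefC I : coef I \in ds_str M.
  apply/mem_set; apply: Defs.diff_mul => //; first exact: Defs.diff_cst.
  by apply: baseC; exact: Cinfty_partials.
pose W : set M := [set p | forall i, `|val (a i) p - val (a i) m| < e].
exists W, r, a.
exists (fun I => exist (fun f => f \in ds_str M) (coef I) (coefC I)); split.
  exists W; split => //; last by move=> i; rewrite subrr normr0.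
  apply: (@weak_open_bigcap _ _ _ _
    (fun i => val (a i) @^-1` [set x | `|x - val (a i) m| < e])) => i.
  apply: weak_open_preimage => //.
  rewrite (_ : [set _ | _] = ball (val (a i) m) e); first exact: ball_open.
  by apply/seteqP; split => x; rewrite -ball_normE /= distrC.
move=> v vW; set p := tpi _; have pW : W p by exact: vW.
have vp j : tpi (tproj j v) = p by exact: tpi_tproj.
have [u vu] := fiber_inclP vp.
(* The contribution of the [j]-th vector, so that the scaled vectors have coordinates
   [base p + \sum_j t j *: d j]. *)
pose d (j : 'I_k) : 'rV[R]_r :=
  \row_i (if sl i == Some j then dfun (a i) (tproj j v) else 0).
(* [B] exceeds every differential occurring below and is positive, so parameters smaller than
   [e / B] keep the scaled vectors in the ball. *)
pose B : R := 1 + \sum_i \sum_j `|dfun (a i) (tproj j v)|.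
have dB i j : `|dfun (a i) (tproj j v)| < B.
  rewrite /B (bigD1 i) //= (bigD1 j) //= -addrA [1 + _]addrCA.
  rewrite ltrDl ltr_pwDl // addr_ge0 ?sumr_ge0 // => l _.
  by rewrite sumr_ge0.
have B0 : 0 < B by rewrite ltr_pwDl // sumr_ge0 // => i _; rewrite sumr_ge0.
rewrite (@multilinear_coeff _ _ _ s (base p) d (omega v) (e / B)) //.
- apply: eq_bigr => I _; rewrite [val _ p]/= /coef /dtensor.
  (* If all slots match, the product of the entries of the [d j] is the tensor product; otherwise
     one entry is 0 and so is the coefficient. *)
  case: forallP => [H|/forallP].
    rewrite mul1r mulrC; congr (_ * _); apply: eq_bigr => j _.
    by rewrite mxE H.
  rewrite negb_forall => /existsP[j jI].
  by rewrite mul0r mul0r (bigD1 j) //= mxE (negbTE jI) !mul0r.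
- exact: divr_gt0.
(* Multilinearity turns the monomial in [t] times [omega v] into [omega] at the scaled vectors,
   where the local formula [gs] applies. *)
move=> t te; rewrite mulrC vu -point_form_scale //.
rewrite gs => [|i].
  congr s; apply/rowP => i; rewrite !mxE summxE aP /bundle_coord.
  case E : (sl i) => [j|].
    rewrite add0r (bigD1 j) //= big1 ?addr0 => [|l lj].
      by rewrite !mxE E eqxx vu.
    by rewrite !mxE E; case: eqP => [[] jl|_];
      rewrite ?mulr0 // jl eqxx in lj *.
  by rewrite big1 ?addr0 // => j _; rewrite !mxE E mulr0.
rewrite aP /bundle_coord; case: (sl i) => [j|]; last exact: pW.
have -> : dfun (a i) (tproj j (fiber_incl (fun _ : 'I_k => 0 : tangent m))) = 0.
  by [].
rewrite subr0.
have -> : dfun (a i) (tproj j (fiber_incl (fun j => t j *: u j))) =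
  t j * dfun (a i) (tproj j v) by rewrite vu.
by rewrite normrM -[e](divfK (lt0r_neq0 B0)) ltr_pM.
Qed.
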